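(* Given an $\alpha$-competitive algorithm for the $k$-server problem on a metric space $\mathbf{S}$, we can construct an $O(k\alpha)$-competitive algorithm for the online ball search problem on $\mathbf{S}$, i.e., its total radius searched (number of steps of $\mathcal{A}$ executed) is at most $O(k\alpha)$ times the cost of any collection of $k$ trajectories.
   Context: Online ball search: $\mathbf{S}$ is a metric space with metric $d$ and fixed starting point $\mathbf{0}$. On each day $t=1,\dots,T$ an instance $I_t$ arrives with unknown true solution $S_t\in\mathbf{S}$, which must be output. A warm start algorithm $\mathcal{A}$ is available: for any $P\in\mathbf{S}$, $\mathcal{A}(I_t,P)$ outputs $S_t$ within at most $d(S_t,P)$ steps; the algorithm may run any number of such searches (interleaved), and its cost is the total number of steps of $\mathcal{A}$ executed (total radius searched). A collection of $k$ trajectories is a partition of $[T]$ into $\mathcal{T}^{(1)},\dots,\mathcal{T}^{(k)}$ together with predictions $P_t\in\mathbf{S}$; for $t\in\mathcal{T}^{(i)}$ let $\mathrm{prev}^{(i)}(t)$ be the previous day in $\mathcal{T}^{(i)}$ (with $P_{\mathrm{prev}}=\mathbf{0}$ if none); its cost is $\sum_{i}\sum_{t\in\mathcal{T}^{(i)}}\big[d(P_t,S_t)+d(P_{\mathrm{prev}^{(i)}(t)},P_t)\big]$. In the $k$-server problem, $k$ servers in $\mathbf{S}$ must be moved so that on each day $t$ some server is at the request $r_t$; cost is the total movement; an online $k$-server algorithm is $\alpha$-competitive if its cost is at most $\alpha$ times the optimal offline cost for every request sequence. *)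

(* Defs.v *)
From mathcomp Require Import all_boot all_order all_algebra.
From mathcomp Require Import all_classical all_reals all_analysis.

Set Implicit Arguments.
Unset Strict Implicit.
Unset Printing Implicit Defensive.

Import Order.TTheory GRing.Theory Num.Theory.

Local Open Scope classical_set_scope.
Local Open Scope ring_scope.

(* Days are numbered from 0: a horizon T concerns the days t < T, and the
   values at t >= T of a sequence indexed by nat play no role. *)

Section KServer.
Variables (R : realType) (S : metricType R) (k : nat) (o : S).

(* c t i is the position of server i before request r t is served, and
   c t.+1 i its position afterwards; all servers start at o. *)
Definition serves (r : nat -> S) (T : nat) (c : nat -> 'I_k -> S) : Prop :=
  (forall i, c 0%N i = o) /\
  (forall t, (t < T)%N -> exists i, c t.+1 i = r t).

Definition movement (T : nat) (c : nat -> 'I_k -> S) : R :=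
  \sum_(t < T) \sum_(i < k) mdist (c t i) (c t.+1 i).

Definition offline_opt (r : nat -> S) (T : nat) : R :=
  inf [set movement T c | c in serves r T].

(* A deterministic online algorithm maps the sequence of requests seen so far
   to the resulting positions of the servers. *)
Definition kserver_alg : Type := seq S -> 'I_k -> S.

Definition kserver_run (A : kserver_alg) (r : nat -> S) : nat -> 'I_k -> S :=
  fun t => A (mkseq r t).

Definition kserver_competitive (alpha : R) (A : kserver_alg) : Prop :=
  forall (T : nat) (r : nat -> S),
    serves r T (kserver_run A r) /\
    movement T (kserver_run A r) <= alpha * offline_opt r T.

End KServer.

Section Trajectories.
Variables (R : realType) (S : metricType R) (k : nat) (o : S).

(* part t is the index of the trajectory containing day t. *)
Definition prev_prediction (part : nat -> 'I_k) (P : nat -> S) (t : nat) : S :=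
  last o [seq P s | s <- iota 0 t & part s == part t].

Definition trajectories_cost (T : nat) (sol : nat -> S)
    (part : nat -> 'I_k) (P : nat -> S) : R :=
  \sum_(i < k) \sum_(t < T | part t == i)
    (mdist (P t) (sol t) + mdist (prev_prediction part P t) (P t)).

End Trajectories.

Section BallSearch.
Variables (R : realType) (S : metricType R) (o : S).

(* nsteps I P is the number of steps after which the search on instance I
   started from P outputs solution I. *)
Record warm_start := WarmStart {
  instance : Type;
  solution : instance -> S;
  nsteps : instance -> S -> nat;
  nsteps_le : forall I P, (nsteps I P)%:R <= mdist (solution I) P }.

(* Within a day nothing is learnt until some search outputs the solution, so
   the interleaving is a fixed sequence: the m-th step executed (m = 0, 1, ...)
   is a step of search number (schedule m).  Starting a search is free: a search
   needing 0 steps, such as one started from the solution itself, outputs the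
   solution at cost 0. *)
Record day_plan := DayPlan {
  nsearch : nat;
  source : 'I_nsearch -> S;
  schedule : nat -> 'I_nsearch }.

Definition search_steps (p : day_plan) (n : nat) (j : 'I_(nsearch p)) : nat :=
  (\sum_(m < n) (schedule p m == j))%N.

Definition found (A : warm_start) (I : instance A) (p : day_plan) (n : nat) :
    bool :=
  [exists j : 'I_(nsearch p), (nsteps I (source j) <= search_steps n j)%N].

(* The search stops, with cost n, as soon as some run outputs the solution. *)
Definition day_cost (A : warm_start) (I : instance A) (p : day_plan) (n : nat) :
    Prop :=
  found I p n /\ (forall m, (m < n)%N -> ~~ found I p m).

(* A deterministic online algorithm maps the true solutions of the past days
   to the plan of the current day; it only accesses the warm start algorithm
   by running it. *)
Definition ball_alg : Type := seq S -> day_plan.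

Definition ball_plan (B : ball_alg) (sol : nat -> S) (t : nat) : day_plan :=
  B (mkseq sol t).

(* The numbers n t are determined by day_cost; their existence says that the
   algorithm outputs the solution every day. *)
Definition ball_competitive (k : nat) (c : R) (B : ball_alg) : Prop :=
  forall (A : warm_start) (T : nat) (I : nat -> instance A),
  let sol := fun t => solution (I t) in
  exists n : nat -> nat,
    (forall t, (t < T)%N -> day_cost (I t) (ball_plan B sol t) (n t)) /\
    (forall (part : nat -> 'I_k) (P : nat -> S),
       (\sum_(t < T) n t)%N%:R <= c * trajectories_cost o T sol part P).

End BallSearch.

(* Main.v *)
Require Import Defs.
From mathcomp Require Import all_boot all_order all_algebra.
From mathcomp Require Import all_classical all_reals all_analysis.
From mathcomp Require Import lra.

Set Implicit Arguments.
Unset Strict Implicit.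
Unset Printing Implicit Defensive.

Import Order.TTheory GRing.Theory Num.Theory.

Local Open Scope ring_scope.

(** Feed the true solutions to the k-server algorithm as requests, and on each
day search round robin from the current server positions.  On day [t] the
search costs at most [k] times the distance from any server to [S_t], hence at
most [k] times the movement of the server that serves [S_t].  Conversely, [k]
trajectories yield an offline schedule in which server [i] visits the solutions
of trajectory [i]; going from one solution to the next through the predictions
shows that it costs at most twice the trajectories. *)

(** For [f] the solutions, these are the positions of the offline servers; for [f] the predictions,
    where the trajectories stand. A trajectory without days so far stands at [o]. *)
Definition last_visited (X : Type) (o : X) (k : nat) (part : nat -> 'I_k)
    (f : nat -> X) (t : nat) (i : 'I_k) : X :=
  last o [seq f s | s <- iota 0 t & part s == i].

Lemma last_visitedS (X : Type) (o : X) (k : nat) (part : nat -> 'I_k)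
    (f : nat -> X) (t : nat) (i : 'I_k) :
  last_visited o part f t.+1 i =
    if part t == i then f t else last_visited o part f t i.
Proof.
rewrite /last_visited -addn1 iotaD add0n filter_cat map_cat last_cat /=.
by case: ifP.
Qed.

(** Each block of [k.+1] consecutive steps meets every residue modulo [k.+1] once; the induction
    splits off the last block. *)
Lemma sum_round_robin (k q : nat) (j : 'I_k.+1) :
  (\sum_(m < q * k.+1) (inZp m == j :> 'I_k.+1) = q)%N.
Proof.
elim: q => [|q IHq]; first by rewrite big_ord0.
rewrite mulSn addnC big_split_ord /= IHq -[RHS]addn1; congr (_ + _)%N.
rewrite (bigD1 j) //= big1 ?addn0 => [|i /negPf ij].
  by rewrite -val_eqE /= modnMDl modn_small ?eqxx.
by rewrite -val_eqE /= modnMDl modn_small // val_eqE ij.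
Qed.

Section KServerTheory.
Variables (R : realType) (S : metricType R) (o : S) (k : nat).
Implicit Types (r : nat -> S) (c : nat -> 'I_k -> S).

Lemma movement_ge0 (T : nat) c : 0 <= movement T c.
Proof. by apply: sumr_ge0 => t _; apply: sumr_ge0 => i _; exact: mdist_ge0. Qed.

Lemma movementS (T : nat) c :
  movement T.+1 c = movement T c + \sum_(i < k) mdist (c T i) (c T.+1 i).
Proof. by rewrite /movement big_ord_recr. Qed.

Lemma offline_opt_le (T : nat) r c :
  serves o r T c -> offline_opt k o r T <= movement T c.
Proof.
move=> rc; apply: ge_inf; last by exists c.
by exists 0 => _ [c' _ <-]; exact: movement_ge0.
Qed.

Lemma serves_last_visited (T : nat) r (part : nat -> 'I_k) :
  serves o r T (last_visited o part r).
Proof. by split=> // t _; exists (part t); rewrite last_visitedS eqxx. Qed.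

Lemma offline_opt_ge0 (T : nat) r : (0 < k)%N -> 0 <= offline_opt k o r T.
Proof.
move=> k0; apply: lb_le_inf => [|_ [c _ <-]]; last exact: movement_ge0.
(* The infimum is over a nonempty set: one server can serve all requests alone. *)
by eexists; exists (last_visited o (fun=> Ordinal k0) r) => //;
  exact: serves_last_visited.
Qed.

Lemma trajectories_costE (T : nat) r (part : nat -> 'I_k) (P : nat -> S) :
  trajectories_cost o T r part P =
    \sum_(t < T) (mdist (P t) (r t) + mdist (prev_prediction o part P t) (P t)).
Proof.
rewrite /trajectories_cost.
by rewrite [RHS](partition_big (fun t : 'I_T => part t) xpredT).
Qed.

(* The second sum is a potential that pays for returning from the last solution
   to the last prediction. *)
Lemma movement_last_visited_potential (T : nat) r (part : nat -> 'I_k)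
    (P : nat -> S) :
  movement T (last_visited o part r) +
    \sum_(i < k) mdist (last_visited o part r T i) (last_visited o part P T i)
  <= 2 * trajectories_cost o T r part P.
Proof.
rewrite trajectories_costE; elim: T => [|T IHT].
  rewrite /movement !big_ord0 add0r mulr0 big1 // => i _.
  by rewrite /last_visited /= mdistxx.
rewrite movementS big_ord_recr /= mulrDr.
apply: le_trans (lerD IHT (lexx _)).
rewrite -!addrA lerD2l -big_split /= (bigD1 (part T)) //=.
rewrite [X in _ <= X + _](bigD1 (part T)) //= !last_visitedS eqxx.
(* The servers of the other trajectories stay put and keep their potential. *)
have -> : \sum_(i < k | i != part T)
   (mdist (last_visited o part r T i) (last_visited o part r T.+1 i) +
    mdist (last_visited o part r T.+1 i) (last_visited o part P T.+1 i)) =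
  \sum_(i < k | i != part T)
    mdist (last_visited o part r T i) (last_visited o part P T i).
  apply: eq_bigr => i; rewrite eq_sym => /negPf iT.
  by rewrite !last_visitedS iT mdistxx add0r.
rewrite -[prev_prediction o part P T]/(last_visited o part P T (part T)).
(* The server goes from [x] to [r T] via [p] and [P T]: the potential pays for [x] to [p]. The
   distance from [P T] to [r T] is paid twice, now and as the new potential, hence the factor 2. *)
move: (last_visited o part r T _) (last_visited o part P T _) => x p.
have := metric_triangle x p (r T); have := metric_triangle p (P T) (r T).
have := mdist_ge0 p (P T); rewrite (metric_sym (r T) (P T)); lra.
Qed.

Lemma offline_opt_le_trajectories (T : nat) r (part : nat -> 'I_k)
    (P : nat -> S) :
  offline_opt k o r T <= 2 * trajectories_cost o T r part P.
Proof.
apply: le_trans (offline_opt_le (serves_last_visited T r part)) _.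
apply: le_trans (movement_last_visited_potential T r part P).
by rewrite lerDl sumr_ge0 // => i _; exact: mdist_ge0.
Qed.

Lemma kserver_competitive_pos (alpha : R) (A : kserver_alg S k) :
  kserver_competitive o alpha A -> (0 < k)%N.
Proof.
move=> /(_ 1%N (fun=> o)) [[_ /(_ 0%N isT) [i _]] _].
exact: leq_ltn_trans (ltn_ord i).
Qed.

(* A negative ratio forces the algorithm never to move, so that [o] is the only
   point of the space. *)
Lemma kserver_competitive_ratio (alpha : R) (A : kserver_alg S k) :
  kserver_competitive o alpha A -> 0 <= alpha \/ forall x, x = o.
Proof.
move=> Aalpha; case: (leP 0 alpha) => [|alpha0]; [by left|right=> x].
have [[run0 /(_ 0%N isT) [i runi]] Ax] := Aalpha 1%N (fun=> x).
have opt0 := offline_opt_ge0 1 (fun=> x) (kserver_competitive_pos Aalpha).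
(* Serving the single request [x] takes some server from [o] to [x]. *)
have : mdist o x <= 0.
  apply: (@le_trans _ _ (movement 1 (kserver_run A (fun=> x)))).
    rewrite /movement big_ord1 (bigD1 i) //= runi run0 lerDl.
    by apply: sumr_ge0 => j _; exact: mdist_ge0.
  by apply: le_trans Ax _; rewrite mulr_le0_ge0 // ltW.
move=> ox; apply/esym/mdist_positivity/eqP.
by rewrite eq_le ox mdist_ge0.
Qed.

End KServerTheory.

Section BallSearchTheory.
Variables (R : realType) (S : metricType R) (o : S) (k : nat).

Definition kserver_ball_alg (A : kserver_alg S k.+1) : ball_alg S :=
  fun past => DayPlan (A past) (fun m => inZp m).

Variables (A : kserver_alg S k.+1) (W : warm_start S).

Lemma found_round_robin (I : instance W) (past : seq S) (j : 'I_k.+1) :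
  found I (kserver_ball_alg A past) (nsteps I (A past j) * k.+1).
Proof. by apply/existsP; exists j; rewrite /search_steps sum_round_robin. Qed.

Lemma day_cost_exists (I : instance W) (past : seq S) :
  exists n, day_cost I (kserver_ball_alg A past) n.
Proof.
have : exists n, found I (kserver_ball_alg A past) n.
  by eexists; exact: (found_round_robin I past ord0).
case/ex_minnP => n foundn n_min; exists n; split=> // m.
by rewrite ltnNge; apply: contra => /n_min.
Qed.

(** After [nsteps I (A past j)] full rounds search [j] has finished, and [n] is the first time at
    which any search has. *)
Lemma day_cost_le (I : instance W) (past : seq S) (n : nat) (j : 'I_k.+1) :
  day_cost I (kserver_ball_alg A past) n ->
  n%:R <= k.+1%:R * mdist (A past j) (solution I).
Proof.
move=> [_ n_min]; apply: (@le_trans _ _ (nsteps I (A past j) * k.+1)%:R).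
  rewrite ler_nat leqNgt; apply/negP => /n_min.
  by rewrite found_round_robin.
by rewrite natrM mulrC ler_pM2l ?ltr0n // metric_sym nsteps_le.
Qed.

Lemma sum_day_cost_le (T : nat) (I : nat -> instance W) (n : nat -> nat)
    (sol := fun t => solution (I t)) :
  serves o sol T (kserver_run A sol) ->
  (forall t, (t < T)%N ->
     day_cost (I t) (ball_plan (kserver_ball_alg A) sol t) (n t)) ->
  (\sum_(t < T) n t)%N%:R <= k.+1%:R * movement T (kserver_run A sol).
Proof.
move=> [_ Asol] ncost; rewrite natr_sum /movement mulr_sumr.
apply: ler_sum => t _; have [i Ai] := Asol t (ltn_ord t).
apply: le_trans (day_cost_le i (ncost t (ltn_ord t))) _.
rewrite ler_pM2l ?ltr0n // (bigD1 i) //= Ai lerDl.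
by apply: sumr_ge0 => j _; exact: mdist_ge0.
Qed.

End BallSearchTheory.

Theorem theorem5p6 :
  exists C : nat,
  forall (R : realType) (S : metricType R) (o : S) (k : nat) (alpha : R)
         (A : kserver_alg S k),
    kserver_competitive o alpha A ->
  exists B : ball_alg S,
    (forall past : seq S, (nsearch (B past) <= k)%N) /\
    ball_competitive o k (C%:R * (k%:R * alpha)) B.
Proof.
(* The 2 is the factor lost between trajectories and offline schedules. *)
exists 2%N => R S o [|k] alpha A Aalpha.
  by have := kserver_competitive_pos Aalpha.
exists (kserver_ball_alg A); split=> // W T I sol.
have [n ncost] := choice (fun t => day_cost_exists A (I t) (mkseq sol t)).
exists n; split=> [t _|part P]; first exact: ncost.
have [Asol Aopt] := Aalpha T sol.
apply: le_trans (sum_day_cost_le Asol (fun t _ => ncost t)) _.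
rewrite mulrCA -!mulrA ler_pM2l ?ltr0n // mulrCA.
apply: (le_trans Aopt).
have opt_le := offline_opt_le_trajectories o T sol part P.
(* Scaling [opt_le] by [alpha] needs [0 <= alpha]; otherwise the space is a single point and both
   sides vanish. *)
have [alpha0|So] := kserver_competitive_ratio Aalpha; first exact: ler_wpM2l.
have cost0 : trajectories_cost o T sol part P = 0.
  rewrite trajectories_costE big1 // => t _.
  by rewrite (So (P t)) (So (sol t)) (So (prev_prediction _ _ _ _)) mdistxx addr0.
have -> : offline_opt k.+1 o sol T = 0.
  by apply/eqP; rewrite eq_le offline_opt_ge0 // andbT -[X in _ <= X](mulr0 2) -cost0.
by rewrite cost0 !mulr0.
Qed.
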